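(* Let $\alpha\in(0,1)$ be the prescribed miscoverage level and let $|\mathcal D_{\mathrm{cal}}|\ge 1$. Suppose that, conditional on $\mathcal D_{\mathrm{tr}}$, the calibration nonconformity scores $\{e_k\}_{k\in\mathcal D_{\mathrm{cal}}}$ together with the nonconformity score $e$ of the future period $[T,T+\Delta)$ form the observations of a strictly stationary $\alpha$-mixing process $\{e_k\}_{k\in\mathbb Z}$ whose mixing coefficients satisfy $\sum_{d\ge 1}\alpha_{\mathrm{mix}}(d)\le\Gamma$ for some finite constant $\Gamma>0$. Let $\mathcal U$ be the uncertainty set for the future period built from the bounds $L_i,U_i$ with threshold $\hat Q(\alpha)$ (all objects as defined in the context). Then the future ignition vector $\mathbf u$ satisfies $$\mathbb P\bigl(\mathbf u\in\mathcal U \,\big|\, \mathcal D_{\mathrm{tr}}\bigr)\ \ge\ 1-\alpha-\epsilon,$$ where $$\epsilon\coloneqq 2\,(3+8\Gamma)^{1/3}\,\frac{\bigl(3+\frac{\log |\mathcal D_{\mathrm{cal}}|}{2\log 2}\bigr)^{2/3}}{|\mathcal D_{\mathrm{cal}}|^{1/3}}=\mathcal O\!\left(\frac{(\log |\mathcal D_{\mathrm{cal}}|)^{2/3}}{|\mathcal D_{\mathrm{cal}}|^{1/3}}\right).$$ In particular, if $\Gamma$ is known, one can simply set $\tilde\alpha\coloneqq(\alpha-\epsilon)_+$ and replace $\hat Q(\alpha)$ with $\hat Q(\tilde\alpha)$ in the bounds $L_i,U_i$.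
   Context: Segments and groups. There are $n$ segments, partitioned into $n'$ disjoint groups; $g_{ii'}\in\{0,1\}$ equals $1$ if segment $i$ belongs to group $i'$ and $0$ otherwise. The group assignments are generated randomly before calibration and remain fixed thereafter. For $\mathbf u=(u_1,\dots,u_n)\in\mathbb R_+^n$ (nonnegative reals) define $$\boldsymbol\nu(\mathbf u)\coloneqq\Bigl(u_1,\dots,u_n,\ \sum_{i:g_{i1}=1}u_i,\ \dots,\ \sum_{i:g_{in'}=1}u_i\Bigr)\in\mathbb R_+^{n+n'},$$ with components $\boldsymbol\nu_i(\mathbf u)$, $i=1,\dots,n+n'$. Data and predictions. Time is divided into intervals indexed by $k$. For each $k$, $\mathbf u_k=(u_{ik})_{i=1}^n$ is the random vector of (nonnegative) ignition counts on the segments, and $\mathbf v_{ik}\in\mathbb R^p$ are observed covariates. The historical data are split as $\mathcal D=\mathcal D_{\mathrm{tr}}\cup\mathcal D_{\mathrm{cal}}$, a training set and a (finite) calibration set; $k\in\mathcal D_{\mathrm{cal}}$ means that time interval $k$ belongs to the calibration set, and $|\mathcal D_{\mathrm{cal}}|$ is the number of such time intervals. A prediction function $\hat\phi:\mathbb R^p\to\mathbb R$ is fitted using $\mathcal D_{\mathrm{tr}}$, and the predictions are $\hat u_{ik}=\exp\{\hat\phi(\mathbf v_{ik})\}$, $\hat{\mathbf u}_k=(\hat u_{ik})_{i=1}^n$. For the future period $[T,T+\Delta)$ the true count vector is $\mathbf u\in\mathbb R_+^n$ and its prediction is $\hat{\mathbf u}=(\hat u_i)_{i=1}^n$ with $\hat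 u_i=\exp\{\hat\phi(\mathbf v_i)\}$, where $\mathbf v_i$ are the covariates of segment $i$ for that period. Nonconformity scores. For $k\in\mathcal D_{\mathrm{cal}}$, $e_k\coloneqq\|\boldsymbol\nu(\mathbf u_k)-\boldsymbol\nu(\hat{\mathbf u}_k)\|_\infty$; for the future period, $e\coloneqq\|\boldsymbol\nu(\mathbf u)-\boldsymbol\nu(\hat{\mathbf u})\|_\infty$. Empirical quantile. For $a\in[0,1)$, $$\hat Q(a)\coloneqq\inf\Bigl\{q\in\mathbb R:\ \frac1{|\mathcal D_{\mathrm{cal}}|}\sum_{k\in\mathcal D_{\mathrm{cal}}}\mathbf 1\{e_k\le q\}\ge 1-a\Bigr\}.$$ Uncertainty set. With $(x)_+\coloneqq\max\{x,0\}$, set for all $i\le n+n'$ $$L_i\coloneqq\bigl(\boldsymbol\nu_i(\hat{\mathbf u})-\hat Q(\alpha)\bigr)_+,\qquad U_i\coloneqq\boldsymbol\nu_i(\hat{\mathbf u})+\hat Q(\alpha),$$ $$\mathcal U\coloneqq\bigl\{\mathbf u'\in\mathbb R_+^n:\ L_i\le\boldsymbol\nu_i(\mathbf u')\le U_i\ \ \forall i\le n+n'\bigr\}.$$ Mixing coefficients. For the process $\{e_k\}_{k\in\mathbb Z}$ and $d\ge1$, $$\alpha_{\mathrm{mix}}(d)\coloneqq\sup_{t\in\mathbb Z}\ \sup_{A\in\sigma(e_k:k\le t),\ B\in\sigma(e_k:k\ge t+d)}\bigl|\mathbb P(A\cap B)-\mathbb P(A)\mathbb P(B)\bigr|,$$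 where $\sigma(\cdot)$ denotes the $\sigma$-field generated by the indicated collection of score variables and, as stationarity and mixing are assumed conditional on $\mathcal D_{\mathrm{tr}}$, probabilities are conditional on $\mathcal D_{\mathrm{tr}}$. Logarithms are natural.
   Formalization: In the closing ''in particular'', coverage at least 1−α with the replaced threshold is asserted only when ε ≤ α (it fails otherwise, e.g. one calibration point with iid continuous scores gives 1/2); in general coverage at least 1−α̃−ε is stated. *)

(* Defs.v *)
From HB Require Import structures.
From mathcomp Require Import all_boot all_order all_algebra.
From mathcomp Require Import finmap.
From mathcomp Require Import all_classical all_reals all_analysis.
Set Implicit Arguments.
Unset Strict Implicit.
Unset Printing Implicit Defensive.
Import Order.TTheory GRing.Theory Num.Theory.
Import numFieldNormedType.Exports.
Local Open Scope classical_set_scope.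
Local Open Scope ring_scope.

Definition is_grouping (n n' : nat) (g : 'I_n -> 'I_n' -> bool) : Prop :=
  forall i, exists! i', g i i'.

Definition nu (R : realType) (n n' : nat) (g : 'I_n -> 'I_n' -> bool)
    (u : 'rV[R]_n) : 'rV[R]_(n + n') :=
  row_mx u (\row_(j < n') \sum_(i < n | g i j) u 0 i).

(* [`| _ |] on row vectors is the sup norm. *)
Definition ncscore (R : realType) (n n' : nat) (g : 'I_n -> 'I_n' -> bool)
    (u uhat : 'rV[R]_n) : R :=
  `| nu g u - nu g uhat |.

Definition prediction (R : realType) (n p : nat) (phi : 'rV[R]_p -> R)
    (v : 'I_n -> 'rV[R]_p) : 'rV[R]_n :=
  \row_(i < n) expR (phi (v i)).

(* For [0 <= a < 1] and a nonempty [Dcal], the set below is nonempty and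
   bounded from below, so that the real-valued [inf] is the genuine infimum. *)
Definition emp_quantile (R : realType) (Dcal : {fset int}) (e : int -> R)
    (a : R) : R :=
  inf [set q : R |
    1 - a <= (#|` Dcal|%:R)^-1 * \sum_(k <- Dcal) (e k <= q)%R%:R].

Definition lower_bound (R : realType) (n n' : nat) (g : 'I_n -> 'I_n' -> bool)
    (uhat : 'rV[R]_n) (q : R) (i : 'I_(n + n')) : R :=
  Num.max (nu g uhat 0 i - q) 0.

Definition upper_bound (R : realType) (n n' : nat) (g : 'I_n -> 'I_n' -> bool)
    (uhat : 'rV[R]_n) (q : R) (i : 'I_(n + n')) : R :=
  nu g uhat 0 i + q.

Definition uncertainty_set (R : realType) (n n' : nat)
    (g : 'I_n -> 'I_n' -> bool) (uhat : 'rV[R]_n) (q : R) : set 'rV[R]_n :=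
  [set u : 'rV[R]_n | (forall i, 0 <= u 0 i) /\
    forall i : 'I_(n + n'),
      lower_bound g uhat q i <= nu g u 0 i <= upper_bound g uhat q i].

(* [kappa] is a regular conditional probability given the random element
   [D]: the random variable [w |-> kappa (D w) A] is a version of
   [P(A | D)] for every event [A]. *)
Definition regular_cond_prob (R : realType) (d d' : measure_display)
    (T : measurableType d) (X : measurableType d') (P : probability T R)
    (D : {mfun T >-> X}) (kappa : R.-pker X ~> T) : Prop :=
  forall (A : set T) (B : set X), measurable A -> measurable B ->
    P (A `&` D @^-1` B) = (\int[P]_(w in D @^-1` B) kappa (D w) A)%E.

(* Equality of the joint laws on the product sigma-algebra of [m.-tuple R]. *)
Definition strictly_stationary (R : realType) (d : measure_display)
    (T : measurableType d) (mu : set T -> \bar R) (xi : int -> T -> R) : Prop :=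
  forall (m : nat) (t : 'I_m -> int) (s : int) (B : set (m.-tuple R)),
    measurable B ->
    pushforward mu (fun w => [tuple xi (t i + s) w | i < m]) B =
    pushforward mu (fun w => [tuple xi (t i) w | i < m]) B.

Definition sigma_gen (R : realType) (d : measure_display)
    (T : measurableType d) (xi : int -> T -> R) (I : set int) : set (set T) :=
  <<s \bigcup_(k in I) preimage_set_system setT (xi k) measurable >>.

Definition alpha_mix (R : realType) (d : measure_display)
    (T : measurableType d) (mu : set T -> \bar R) (xi : int -> T -> R)
    (l : nat) : \bar R :=
  ereal_sup [set r | exists (t : int) (A B : set T),
    [/\ sigma_gen xi [set k | k <= t] A,
        sigma_gen xi [set k | t + l%:Z <= k] B &
        r = `| mu (A `&` B) - mu A * mu B |%E]].

Definition alpha_mixing (R : realType) (d : measure_display)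
    (T : measurableType d) (mu : set T -> \bar R) (xi : int -> T -> R) : Prop :=
  alpha_mix mu xi l @[l --> \oo] --> 0%E.

Definition rate (R : realType) (m : nat) : R :=
  ln m%:R `^ (2 / 3) / m%:R `^ 3^-1.

Definition epsilon (R : realType) (Gamma : R) (m : nat) : R :=
  2 * (3 + 8 * Gamma) `^ 3^-1 *
  ((3 + ln m%:R / (2 * ln 2)) `^ (2 / 3) / m%:R `^ 3^-1).

(* Main.v *)
(* A uniform bound on the empirical distribution function is not needed: since
   only the miscoverage at level [a] matters, it suffices to control it at one
   deterministic threshold.  With [eps = 2 delta], let [q] be a
   [(1 - a - delta)]-quantile of the common law of the scores.  If the future
   score exceeds the empirical quantile, then either it exceeds [q], which has
   probability at most [a + delta], or at least a fraction [1 - a] of the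
   calibration scores lie strictly below [q], although each does so with
   probability at most [1 - a - delta].  By Chebyshev's inequality the latter
   has probability at most [delta], because the covariances of the indicators
   of these events are bounded by the mixing coefficients, so that their sum has
   variance at most [m (1 + 2 Gamma)]. *)

Require Import Defs.
From HB Require Import structures.
From mathcomp Require Import all_boot all_order all_algebra.
From mathcomp Require Import finmap.
From mathcomp Require Import all_classical all_reals all_analysis.
From mathcomp Require Import measurable_realfun zify ring lra.
Import Order.TTheory GRing.Theory Num.Theory.
Import numFieldNormedType.Exports.
Local Open Scope classical_set_scope.
Local Open Scope ring_scope.

(** * Quantiles of a distribution function *)

Section cdf_crossing.
Local Open Scope ereal_scope.

(** The infimum of the points where the distribution function reaches [t] works: right continuity
    gives one inequality, minimality the other. The strict event on the left keeps this true when
    [X] has an atom at [q]. *)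
Lemma cdf_crossing (R : realType) (d : measure_display) (T : measurableType d)
    (P : probability T R) (X : {RV P >-> R}) (t : R) : (0 < t < 1)%R ->
  exists q : R, P [set w | (X w < q)%R] <= t%:E /\
                t%:E <= P [set w | (X w <= q)%R].
Proof.
move=> /andP[t0 t1].
pose S := [set q : R | t%:E <= cdf X q].
have cdfE q : cdf X q = P [set w | (X w <= q)%R].
  by rewrite /cdf /distribution /pushforward; congr (P _); apply/seteqP;
     split=> w /=; rewrite in_itv.
have S_up q r : (q <= r)%R -> S q -> S r.
  by move=> qr Sq; apply: le_trans Sq _; exact: cdf_nondecreasing.
have [M [_ SM]] : \forall q \near +oo%R, S q.
  have tn : nbhs (1 : \bar R) [set x : \bar R | t%:E < x].
    apply: open_nbhs_nbhs; split; last by rewrite /= lte_fin.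
    exact: (@open_ereal_gt_ereal R t%:E).
  have : \forall q \near +oo%R, t%:E < cdf X q by exact: (cvg_cdfy1 X tn).
  move=> h; near=> q; apply: ltW; near: q; exact: h.
have [m [_ Sm]] : \forall q \near -oo%R, ~ S q.
  have tn : nbhs (0 : \bar R) [set x | x < t%:E].
    apply: open_nbhs_nbhs; split; last by rewrite /= lte_fin.
    exact: (@open_ereal_lt_ereal R t%:E).
  have : \forall q \near -oo%R, cdf X q < t%:E by exact: (cvg_cdfNy0 X tn).
  move=> h; near=> q; apply/negP; rewrite -ltNge; near: q; exact: h.
have S0 : S !=set0 by exists (M + 1)%R; apply: SM; rewrite ltrDl.
have Slb : has_lbound S.
  exists (m - 1)%R => q Sq; rewrite leNgt; apply/negP => qm.
  by apply: (Sm (m - 1)%R); [rewrite gtrDl ltrN10 | exact: S_up (ltW qm) Sq].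
have ltS q : (inf S < q)%R -> S q.
  by move=> /(inf_lt S0)[r Sr /ltW rq]; exact: S_up rq Sr.
have Slt q : (q < inf S)%R -> cdf X q < t%:E.
  move=> qS; rewrite ltNge; apply/negP => Sq.
  by move: qS; rewrite ltNge => /negP; apply; exact: ge_inf.
exists (inf S); split; last first.
  rewrite -cdfE; apply: (cvge_to_ge (@cdf_right_continuous _ _ _ P X (inf S))).
  by near=> q; apply: ltS; near: q; exact: nbhs_right_gt.
(* Continuity from below: the events [F n] increase to [X < inf S], and each has probability below
   [t]. *)
pose F n := [set w | (X w <= inf S - n.+1%:R^-1)%R].
have mF n : measurable (F n).
  rewrite (_ : F n = X @^-1` `]-oo, (inf S - n.+1%:R^-1)%R]).
    exact: measurable_funPTI.
  by apply/seteqP; split=> w /=; rewrite in_itv.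
have -> : [set w | (X w < inf S)%R] = \bigcup_n F n.
  apply/seteqP; split=> [w /= Xw|w [n _] /= Xw]; last first.
    by apply: le_lt_trans Xw _; rewrite gtrBl invr_gt0.
  have SX0 : (0 < inf S - X w)%R by rewrite subr_gt0.
  have [n _ /(_ n (leqnn _)) /= nX] := near_infty_natSinv_lt (PosNum SX0).
  by exists n => //; rewrite /F /= lerBrDl -lerBrDr ltW.
have cF : (P \o F) n @[n --> \oo] --> P (\bigcup_n F n).
  apply: nondecreasing_cvg_mu => //; first exact: bigcupT_measurable.
  move=> n k nk; apply/subsetPset => w /= /le_trans; apply.
  by rewrite lerD2l lerN2 lef_pV2 ?posrE// ler_nat.
apply: (cvge_to_le cF); near=> n; rewrite /= -cdfE ltW// Slt//.
by rewrite gtrBl invr_gt0.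
Unshelve. all: by end_near. Qed.

End cdf_crossing.

(** * Covariances of indicators and variances of sums *)

Lemma indic_Lfun2 (R : realType) (d : measure_display) (T : measurableType d)
    (P : probability T R) (A : set T) : measurable A ->
  (\1_A : T -> R) \in Lfun P 2%:E.
Proof.
move=> mA; rewrite inE/=; apply/andP; split; rewrite inE/=.
  exact: measurable_indic.
rewrite /finite_norm unlock poweR_lty//.
apply: (@le_lt_trans _ _ (\int[P]_x (\1_A x)%:E)%E); last first.
  by rewrite integral_indic// setIT (le_lt_trans (probability_le1 _ _)) ?ltry.
rewrite le_eqVlt; apply/orP; left; apply/eqP.
apply: eq_integral => w _ /=; rewrite indicE.
by case: (w \in A); rewrite /= ?normr1 ?normr0 ?powR1 ?powR0.
Qed.

Lemma covariance_suml (R : realType) (d : measure_display)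
    (T : measurableType d) (P : probability T R) (I : Type) (s : seq I)
    (X : I -> T -> R) (Y : T -> R) :
  (forall i, X i \in Lfun P 2%:E) -> Y \in Lfun P 2%:E ->
  covariance P (\sum_(i <- s) X i) Y = (\sum_(i <- s) covariance P (X i) Y)%E.
Proof.
move=> X2 Y2; elim: s => [|i s IHs].
  by rewrite !big_nil (_ : 0 = cst 0) // covariance_cst_l.
by rewrite !big_cons -IHs covarianceDl// rpred_sum ?lee1n.
Qed.

Lemma variance_sum (R : realType) (d : measure_display) (T : measurableType d)
    (P : probability T R) (I : Type) (s : seq I) (X : I -> T -> R) :
  (forall i, X i \in Lfun P 2%:E) ->
  variance P (\sum_(i <- s) X i) =
  (\sum_(i <- s) \sum_(j <- s) covariance P (X i) (X j))%E.
Proof.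
move=> X2; rewrite /variance covariance_suml ?rpred_sum ?lee1n//.
apply: eq_bigr => i _; rewrite covarianceC covariance_suml//.
by apply: eq_bigr => j _; exact: covarianceC.
Qed.

Lemma covariance_indic (R : realType) (d : measure_display)
    (T : measurableType d) (P : probability T R) (A B : set T) :
  measurable A -> measurable B ->
  covariance P (\1_A) (\1_B) = (P (A `&` B) - P A * P B)%E.
Proof.
move=> mA mB; have mAB := measurableI _ _ mA mB.
have L1 C : measurable C -> (\1_C : T -> R) \in Lfun P 1.
  move=> mC; apply: Lfun_subset12; last exact: indic_Lfun2.
  exact: fin_num_measure.
rewrite covarianceE ?L1 ?expectation_indic//.
  by rewrite (_ : \1_A * \1_B = \1_(A `&` B)) ?expectation_indic// indicI.
by rewrite (_ : \1_A * \1_B = \1_(A `&` B)) ?L1// indicI.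
Qed.

(** * Mixing coefficients and the variance of counts *)

Lemma lee_sum_inj (R : realType) (I : eqType) (s : seq I) (p : pred I)
    (f : I -> nat) (a : nat -> \bar R) (c : \bar R) :
  uniq s -> {in [pred i | p i] &, injective f} ->
  (forall i, p i -> (0 < f i)%N) ->
  (forall n, (0 <= a n)%E) ->
  (\sum_(1 <= n <oo) a n <= c)%E -> (\sum_(i <- s | p i) a (f i) <= c)%E.
Proof.
move=> us f_inj f_gt0 a_ge0; apply: le_trans.
(* The indices in [t] are distinct and lie in [[1, N)], so the left side is a subsum of a partial
   sum of the nonnegative series. *)
pose t := [seq f i | i <- s & p i]; pose N := (\max_(n <- t) n).+1.
apply: le_trans (nneseries_lim_ge N _) => //.
have tN n : n \in t -> (1 <= n < N)%N.
  move=> nt; rewrite ltnS (leq_bigmax_seq n nt)// andbT.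
  by move: nt => /mapP[i]; rewrite mem_filter => /andP[/f_gt0 + _] ->.
rewrite -big_filter -(big_map f xpredT a) -/t.
rewrite (perm_big [seq n <- index_iota 1 N | n \in t]); last first.
  apply: uniq_perm.
  - rewrite map_inj_in_uniq ?filter_uniq// => i j; rewrite !mem_filter.
    by move=> /andP[pi _] /andP[pj _]; exact: f_inj.
  - exact/filter_uniq/iota_uniq.
  - move=> n; rewrite mem_filter mem_index_iota /=.
    by case: (boolP (n \in t)) => // /tN ->.
by rewrite big_filter big_mkcond; apply: lee_sum => n _; case: ifP.
Qed.

(** On either side of [k] each distance occurs at most once, so each side contributes at most [c].
    This is the origin of the factor 2 in [1 + 2 * Gamma]. *)
Lemma lee_sum_distn (R : realType) (s : seq int) (k : int)
    (a : nat -> \bar R) (c : \bar R) :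
  uniq s -> (forall n, (0 <= a n)%E) -> (\sum_(1 <= n <oo) a n <= c)%E ->
  (\sum_(l <- s | l != k) a `|l - k|%N <= c + c)%E.
Proof.
move=> us a_ge0 ac; rewrite (bigID (fun l => l < k)%R) /=.
apply: leeD.
  apply: lee_sum_inj => // [i j|i]; rewrite ?inE => /andP[_ +]; last by lia.
  by move=> ik /andP[_ jk]; lia.
apply: lee_sum_inj => // [i j|i]; rewrite ?inE => /andP[+ +]; last by lia.
by move=> ? ? /andP[? ?]; lia.
Qed.

Section mixing.
Context (R : realType) (d : measure_display) (T : measurableType d).
Variables (P : probability T R) (xi : int -> {mfun T >-> R}).

Lemma alpha_mix_ge0 n : (0 <= alpha_mix P xi n)%E.
Proof.
apply: le_trans (ereal_sup_ubound _); last first.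
  by exists 0, set0, set0; split=> //; exact: sigma_algebra0.
exact: abse_ge0.
Qed.

Lemma sigma_gen_preimage (I : set int) (k : int) (C : set R) :
  I k -> measurable C -> sigma_gen xi I (xi k @^-1` C).
Proof.
move=> Ik mC; apply: sub_sigma_algebra; exists k => //.
by exists C => //; rewrite setTI.
Qed.

Lemma covariance_alpha_mix (k l : int) (C : set R) : k != l -> measurable C ->
  (covariance P \1_(xi k @^-1` C) \1_(xi l @^-1` C) <=
    alpha_mix P xi `|l - k|)%E.
Proof.
(* The mixing coefficient puts the past event first; symmetry of the covariance reduces to that
   order. *)
move=> kl mC; wlog lt_kl : k l kl / k < l.
  move=> h; have [lk|lk|E] := ltgtP k l; [exact: h| |by rewrite E eqxx in kl].
  rewrite covarianceC (_ : `|l - k|%N = `|k - l|%N); last by lia.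
  by apply: h lk; lia.
rewrite covariance_indic; [|exact: measurable_funPTI|exact: measurable_funPTI].
apply: le_trans (lee_abs _) _; apply: ereal_sup_ubound.
exists k, (xi k @^-1` C), (xi l @^-1` C); split=> //;
  apply: sigma_gen_preimage => //=.
by lia.
Qed.

(** In each row of the covariance matrix of the indicators, the diagonal entry is at most 1 and the
    other entries sum to at most [2 * Gamma]. *)
Lemma variance_count_le (s : seq int) (C : set R) (Gamma : R) :
  uniq s -> measurable C ->
  (\sum_(1 <= n <oo) alpha_mix P xi n <= Gamma%:E)%E ->
  (variance P (\sum_(k <- s) \1_(xi k @^-1` C))%R <=
    ((size s)%:R * (1 + 2 * Gamma))%:E)%E.
Proof.
move=> us mC aG.
have mA k : measurable (xi k @^-1` C) by exact: measurable_funPTI.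
rewrite variance_sum => [|k]; last exact: indic_Lfun2.
apply: (@le_trans _ _ (\sum_(k <- s) (1 + 2 * Gamma)%:E)%E); last first.
  rewrite sumEFin lee_fin big_const_seq count_predT iter_addr_0.
  by rewrite -[leLHS]mulr_natl.
rewrite !big_seq; apply: lee_sum => k ks.
rewrite (bigD1_seq k)//= EFinD; apply: leeD.
  rewrite covariance_indic// setIid.
  apply: (@le_trans _ _ (P (xi k @^-1` C))); last exact: probability_le1.
  by rewrite leeBlDr ?leeDl ?mule_ge0// fin_numM ?fin_num_measure.
rewrite mulr_natl mulr2n EFinD.
apply: le_trans (lee_sum_distn _ _ k _ _ us alpha_mix_ge0 aG).
by apply: lee_sum => l lk; apply: covariance_alpha_mix; rewrite // eq_sym.
Qed.

End mixing.

(** * The empirical quantile *)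

(** Turns a comparison with an infimum into one with a finite count. The count is strict because [x]
    exceeds the quantile exactly when some [q < x] already reaches level [1 - a]. *)
Lemma le_emp_quantile (R : realType) (D : {fset int}) (e : int -> R) (a x : R) :
  0 <= a < 1 -> (0 < #|` D|)%N ->
  (x <= emp_quantile D e a) =
  ((#|` D|%:R)^-1 * \sum_(k <- D) (e k < x)%R%:R < 1 - a).
Proof.
move=> /andP[a_ge0 a_lt1] D_gt0; rewrite /emp_quantile.
have m_gt0 : 0 < #|` D|%:R :> R by rewrite ltr0n.
set S := [set q : R | _].
have S0 : S !=set0.
  exists (\big[Num.max/0]_(k <- D) e k); rewrite /S /=.
  rewrite (eq_big_seq (fun=> 1%:R)) => [|k kD]; last by rewrite le_bigmax_seq.
  by rewrite -natr_sum sum1_size mulVf ?gt_eqF// gerBl.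
(* Below the minimum of 0 and the scores the empirical fraction is 0, which is less than [1 - a]. *)
have lbS : has_lbound S.
  exists (- \big[Num.max/0]_(k <- D) - e k) => q Sq.
  rewrite leNgt; apply/negP => qlt.
  suff Sq0 : \sum_(k <- D) (e k <= q)%R%:R = 0 :> R.
    by move: Sq; rewrite /S /= Sq0 mulr0 subr_le0 leNgt a_lt1.
  rewrite big1_seq// => k /andP[_ kD]; rewrite leNgt (lt_le_trans qlt)//.
  by rewrite lerNl (le_bigmax_seq _ _ _ (fun k => - e k)).
rewrite [LHS]leNgt [RHS]ltNge; congr (~~ _); apply/idP/idP.
  move=> /(inf_lt S0)[q Sq qx]; apply: le_trans Sq _.
  rewrite ler_pM2l ?invr_gt0//; apply: ler_sum => k _.
  by rewrite ler_nat; case: (leP (e k) q) => // /le_lt_trans ->.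
(* The largest score below [x] is at least the empirical quantile. *)
move=> ax; pose q := \big[Num.max/(x - 1)]_(k <- D | e k < x) e k.
have qx : q < x by apply: bigmax_lt => //; rewrite gtrBl.
apply: le_lt_trans qx; apply: ge_inf => //; apply: le_trans ax _.
rewrite ler_pM2l ?invr_gt0//; rewrite !big_seq; apply: ler_sum => k kD.
rewrite ler_nat; case: (ltP (e k) x) => // ekx.
by rewrite (_ : e k <= q)// /q le_bigmax_seq.
Qed.

Lemma strictly_stationary_marginal (R : realType) (d : measure_display)
    (T : measurableType d) (mu : set T -> \bar R) (xi : int -> T -> R)
    (k l : int) (C : set R) :
  strictly_stationary mu xi -> measurable C ->
  mu (xi k @^-1` C) = mu (xi l @^-1` C).
Proof.
move=> st mC.
have mB : measurable [set x : 1.-tuple R | C (tnth x ord0)].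
  by rewrite -[X in measurable X]setTI; exact: measurable_tnth.
(* Stationarity of a one-point tuple at [l], shifted by [k - l]. *)
have := st 1%N (fun=> l) (k - l) _ mB.
rewrite /pushforward /preimage /=.
under eq_set do rewrite tnth_mktuple.
under [in RHS]eq_set do rewrite tnth_mktuple.
by rewrite addrC subrK.
Qed.

(** * Coverage of the empirical quantile under a fixed probability *)

Section coverage.
Context (R : realType) (d : measure_display) (T : measurableType d).
Variables (P : probability T R) (xi : int -> {mfun T >-> R}).
Variables (D : {fset int}) (kf : int) (a : R).
Let m : R := #|` D|%:R.

Lemma measurable_le_emp_quantile : 0 <= a < 1 -> (0 < #|` D|)%N ->
  measurable [set w | xi kf w <= emp_quantile D (xi ^~ w) a].
Proof.
move=> a01 D0; pose N w : R := m^-1 * \sum_(k <- D) (xi k w < xi kf w)%R%:R.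
have mN : measurable_fun setT N.
  apply: measurable_funM => //; apply: measurable_sum => k.
  apply: (measurableT_comp (f := fun b : bool => b%:R : R)) => //.
  exact: measurable_fun_ltr.
rewrite (_ : [set w | _] = N @^-1` `]-oo, (1 - a)[).
  by rewrite -[X in measurable X]setTI; exact: mN.
by apply/seteqP; split=> w /=; rewrite in_itv /= le_emp_quantile.
Qed.

(** The condition on [m * delta ^+ 3] is what brings Chebyshev's bound
    [m * (1 + 2 * Gamma) / (m * delta) ^+ 2] down to [delta]. *)
Lemma emp_quantile_coverage (Gamma delta : R) :
  strictly_stationary P (fun k => xi k : T -> R) ->
  (\sum_(1 <= n <oo) alpha_mix P (fun k => xi k : T -> R) n <= Gamma%:E)%E ->
  0 <= a < 1 -> (0 < #|` D|)%N -> 0 < delta ->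
  1 + 2 * Gamma <= m * delta ^+ 3 ->
  ((1 - a - 2 * delta)%:E <=
    P [set w | (xi kf w <= emp_quantile D (xi ^~ w) a)%R])%E.
Proof.
move=> st aG a01 D0 d0 mdelta; have m0 : 0 < m by rewrite ltr0n.
(* At a nonpositive level the claimed lower bound is negative; otherwise the level lies in [(0, 1)]
   and has a crossing point [q]. *)
have [t0|t0] := leP (1 - a - delta) 0.
  by apply: (@le_trans _ _ 0%E) => //; rewrite lee_fin; lra.
have t01 : 0 < 1 - a - delta < 1 by move: a01 => /andP[? ?]; rewrite t0; lra.
have [q [ltq leq]] := cdf_crossing _ _ _ P (xi kf) _ t01.
pose C : set R := `]-oo, q[%classic.
have mC : measurable C by exact: measurable_itv.
have mA k : measurable (xi k @^-1` C) by exact: measurable_funPTI.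
have AE k : xi k @^-1` C = [set w | xi k w < q].
  by apply/seteqP; split=> w; rewrite /C /= in_itv.
pose N0 : T -> R := \sum_(k <- D) \1_(xi k @^-1` C).
have mN0 : N0 \in mfun.
  rewrite inE; rewrite /N0 fct_sumE; apply: measurable_sum => k.
  exact: measurable_indic.
pose N : {RV P >-> R} := mfun_Sub mN0.
have NE w : N0 w = \sum_(k <- D) (xi k w < q)%R%:R.
  rewrite /N0 fct_sumE; apply: eq_bigr => k _.
  by rewrite indicE AE; congr (_%:R); rewrite mem_setE.
pose pq := fine (P (xi kf @^-1` C)).
have pqE : P (xi kf @^-1` C) = pq%:E by rewrite fineK// fin_num_measure.
have EN : fine (expectation P N) = m * pq.
  pose s := [seq \1_(xi k @^-1` C) : T -> R | k <- D].
  have NsE : (N : T -> R) = \sum_(Y <- s) Y by rewrite /s big_map.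
  rewrite NsE expectation_sum => [|_ /mapP[k _ ->]]; last first.
    by apply: Lfun_subset12; [exact: fin_num_measure | exact: indic_Lfun2].
  rewrite /s big_map (eq_bigr (fun=> pq%:E)) => [|k _]; last first.
    rewrite expectation_indic// -pqE.
    exact: (strictly_stationary_marginal _ _ _ P (fun k => xi k : T -> R)).
  by rewrite sumEFin /= big_const_seq count_predT iter_addr_0 -mulr_natl.
have pq_le : pq <= 1 - a - delta by rewrite -lee_fin -pqE AE.
have md0 : 0 < m * delta by rewrite mulr_gt0.
have cheb := chebyshev N md0.
have vN : (variance P N <= (m * (1 + 2 * Gamma))%:E)%E.
  by have := variance_count_le _ _ _ P xi D _ _ (fset_uniq D) mC aG.
(* The two bad events: the future score exceeds [q], or the number of calibration scores below [q]
   is far from its mean. *)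
pose B1 := [set w | q < xi kf w].
pose B2 := [set w | m * delta <= `|N w - fine (expectation P N)|].
have mB1 : measurable B1.
  rewrite (_ : B1 = xi kf @^-1` `]q, +oo[); first exact: measurable_funPTI.
  by apply/seteqP; split=> w /=; rewrite in_itv/= andbT.
have mB2 : measurable B2.
  rewrite (_ : B2 = (fun w => `|N w - fine (expectation P N)|) @^-1`
      `[m * delta, +oo[).
    rewrite -[X in measurable X]setTI.
    suff mf : measurable_fun setT (fun w => `|N w - fine (expectation P N)|).
      exact: mf.
    by apply: measurableT_comp => //; exact: measurable_funB.
  by apply/seteqP; split=> w /=; rewrite in_itv/= andbT.
have PB1 : (P B1 <= (a + delta)%:E)%E.
  rewrite (_ : B1 = ~` [set w | xi kf w <= q]); last first.
    by apply/seteqP; split=> w; rewrite /B1 /= ltNge => /negP.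
  have mB : measurable [set w | xi kf w <= q].
    rewrite (_ : [set w | _] = xi kf @^-1` `]-oo, q]).
      exact: measurable_funPTI.
    by apply/seteqP; split=> w /=; rewrite in_itv.
  rewrite probability_setC//; move: leq.
  rewrite -(fineK (fin_num_measure P _ mB)).
  by rewrite -EFinB !lee_fin; lra.
have PB2 : (P B2 <= delta%:E)%E.
  apply: le_trans cheb _.
  rewrite lee_pdivrMl ?exprn_gt0//; apply: le_trans vN _.
  rewrite lee_fin (_ : (m * delta) ^+ 2 * delta = m * (m * delta ^+ 3)).
    by rewrite ler_pM2l.
  by ring.
set G := [set w | _].
have mG : measurable G by exact: measurable_le_emp_quantile.
(* If the future score exceeds the empirical quantile but not [q], then at least [m * (1 - a)]
   calibration scores lie below it, hence below [q], while the mean of that count is at most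
   [m * (1 - a - delta)]. *)
have sub : ~` G `<=` B1 `|` B2.
  move=> w /negP; rewrite le_emp_quantile// -leNgt => aN.
  have [qw|wq] := ltP q (xi kf w); [by left | right].
  rewrite /B2 /= EN (le_trans _ (ler_norm _))// lerBrDr.
  apply: (@le_trans _ _ (m * (1 - a))).
    by rewrite -mulrDr ler_pM2l//; lra.
  rewrite -ler_pdivlMl//; apply: le_trans aN _; rewrite ler_pM2l ?invr_gt0//.
  rewrite -/(N0 w) NE; apply: ler_sum => k _; rewrite ler_nat.
  by case: (ltP (xi k w) (xi kf w)) => // /lt_le_trans ->.
have PG : (P (~` G) <= (a + delta + delta)%:E)%E.
  apply: (@le_trans _ _ (P (B1 `|` B2))).
    apply: le_measure => //; rewrite inE; first exact: measurableC.
    exact: measurableU.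
  by apply: le_trans (measureU2 _ _ _) _ => //; rewrite EFinD leeD.
have := PG; rewrite probability_setC// -(fineK (fin_num_measure P G mG)).
by rewrite -EFinB !lee_fin; lra.
Qed.
End coverage.

(** * The error term and its rate *)

(** With [delta] half of [epsilon], cubing gives [m * delta ^+ 3 = (3 + 8 * Gamma) * L ^+ 2], and
    [L >= 3] leaves ample room. *)
Lemma epsilon_deviation (R : realType) (Gamma : R) (m : nat) :
  0 < Gamma -> (0 < m)%N ->
  exists2 delta : R, 0 < delta & epsilon Gamma m = 2 * delta /\
    1 + 2 * Gamma <= m%:R * delta ^+ 3.
Proof.
move=> G0 m0; have mR0 : 0 < m%:R :> R by rewrite ltr0n.
have ln2_gt0 : 0 < ln 2 :> R by rewrite ln_gt0// ltr1n.
pose L : R := 3 + ln m%:R / (2 * ln 2).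
have L3 : 3 <= L by rewrite lerDl divr_ge0// ?ln_ge0 ?ler1n ?mulr_ge0 ?ltW.
have cube x (y : R) : 0 <= x -> (x `^ y) ^+ 3 = x `^ (y * 3).
  by move=> x0; rewrite -powR_mulrn ?powR_ge0// -powRrM.
exists ((3 + 8 * Gamma) `^ 3^-1 * (L `^ (2 / 3) / m%:R `^ 3^-1)).
  have L0 : 0 < L by apply: lt_le_trans L3.
  by apply: mulr_gt0; [|apply: divr_gt0]; apply: powR_gt0 => //; lra.
split; first by rewrite /epsilon -/L -mulrA.
rewrite !exprMn exprVn !cube ?ler0n//; [|lra|lra].
rewrite mulVf// !divfK// !powRr1 ?ler0n//; last lra.
rewrite powR_mulrn; last lra.
rewrite (_ : m%:R * _ = (3 + 8 * Gamma) * L ^+ 2); last first.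
  by field; rewrite gt_eqF.
have : 9 <= L ^+ 2 by rewrite (_ : 9 = 3 ^+ 2) ?lerXn2r ?nnegrE//; lra.
by nra.
Qed.

Lemma epsilon_rate (R : realType) (Gamma : R) : 0 < Gamma ->
  epsilon Gamma =O_\oo (@rate R).
Proof.
move=> G0; have ln2_gt0 : 0 < ln 2 :> R by rewrite ln_gt0// ltr1n.
(* Once [ln m >= ln 2], the constant 3 is at most [3 / ln 2 * ln m], so the whole logarithmic factor
   is at most [c * ln m]. *)
pose c : R := 3 / ln 2 + (2 * ln 2)^-1.
have c0 : 0 < c by rewrite addr_gt0 ?divr_gt0 ?invr_gt0 ?mulr_gt0.
apply/eqO_exP; exists (2 * (3 + 8 * Gamma) `^ 3^-1 * c `^ (2 / 3)).
  by apply: mulr_gt0; [apply: mulr_gt0|] => //; apply: powR_gt0 => //; lra.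
(* The bound starts at 2 because [rate] vanishes at 1 and [epsilon] does not. *)
exists 2%N => // m /= m2.
have mR0 : 0 < m%:R :> R by rewrite ltr0n (leq_trans _ m2).
have lnm : ln 2 <= ln m%:R :> R.
  by rewrite ler_ln ?posrE ?ler_nat// (leq_trans _ m2).
have lnm0 : 0 < ln m%:R :> R by exact: lt_le_trans lnm.
have L0 : 0 <= 3 + ln m%:R / (2 * ln 2) :> R.
  by rewrite addr_ge0// divr_ge0 ?mulr_ge0// ltW.
rewrite /epsilon /rate !ger0_norm ?mulr_ge0 ?invr_ge0 ?powR_ge0//.
rewrite -!mulrA ler_pM2l// ler_pM2l ?powR_gt0//; last by lra.
rewrite [leRHS]mulrA -powRM ?(ltW c0) ?(ltW lnm0)//.
rewrite ler_pM2r ?invr_gt0 ?powR_gt0//.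
apply: ge0_ler_powR; rewrite ?nnegrE ?mulr_ge0 ?(ltW c0) ?(ltW lnm0)//.
have -> : c * ln m%:R = 3 * (ln m%:R / ln 2) + ln m%:R / (2 * ln 2).
  by rewrite /c; field; rewrite gt_eqF.
by rewrite lerD2r ler_peMr// ler_pdivlMr ?mul1r.
Qed.

(** * The uncertainty set as a sup-norm ball *)

Lemma nu_ge0 (R : realType) (n n' : nat) (g : 'I_n -> 'I_n' -> bool)
    (u : 'rV[R]_n) (i : 'I_(n + n')) :
  (forall i, 0 <= u 0 i) -> 0 <= nu g u 0 i.
Proof.
move=> u0; rewrite /nu mxE.
by case: (fintype.split i) => j //; rewrite mxE sumr_ge0.
Qed.

(** The norm is a maximum with default 0, hence the condition [0 <= q], which matters when there are
    no coordinates. *)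
Lemma ncscore_le (R : realType) (n n' : nat) (g : 'I_n -> 'I_n' -> bool)
    (u uhat : 'rV[R]_n) (q : R) : 0 <= q ->
  ncscore g u uhat <= q <-> forall i, `|nu g u 0 i - nu g uhat 0 i| <= q.
Proof.
move=> q0; rewrite /ncscore /Num.norm /= mx_normrE; split=> [h i|h].
  apply: le_trans h; apply: le_trans (le_bigmax _ _ (ord0, i)).
  by rewrite /= !mxE.
apply: bigmax_le => // -[i j] _ /=.
by rewrite !mxE ord1; have := h j; rewrite !mxE.
Qed.

(** Clipping the lower bounds at 0 excludes no nonnegative vector, since its image under [nu] is
    nonnegative. *)
Lemma mem_uncertainty_set (R : realType) (n n' : nat)
    (g : 'I_n -> 'I_n' -> bool) (u uhat : 'rV[R]_n) (q : R) :
  (forall i, 0 <= u 0 i) -> 0 <= q ->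
  uncertainty_set g uhat q u <-> ncscore g u uhat <= q.
Proof.
move=> u0 q0; rewrite ncscore_le//; split=> [[_ h] i|h].
  have := h i; rewrite /lower_bound /upper_bound ge_max ler_distl.
  by move=> /andP[/andP[-> _] ->].
split=> // i; have := h i.
rewrite /lower_bound /upper_bound ge_max ler_distl nu_ge0// andbT.
by move=> /andP[-> ->].
Qed.

Lemma eq_emp_quantile (R : realType) (D : {fset int}) (e e' : int -> R)
    (a : R) :
  {in D, e =1 e'} -> emp_quantile D e a = emp_quantile D e' a.
Proof.
move=> ee'; congr inf; apply: eq_set => q; congr (_ <= _ * _).
by apply: eq_big_seq => k kD; rewrite ee'.
Qed.

(** * Conditioning on the training data *)

Section kernel_probability.
Context (R : realType) (d d' : measure_display).
Context (X : measurableType d) (T : measurableType d').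
Variables (kappa : R.-pker X ~> T) (x : X).

(** A named copy of [kappa x] that carries the probability structure, so that results for a fixed
    probability apply to the conditional law. *)
Definition kernel_probability : set T -> \bar R := kappa x.

HB.instance Definition _ := Measure.on kernel_probability.

HB.instance Definition _ :=
  Measure_isProbability.Build _ _ _ kernel_probability (prob_kernel x).

End kernel_probability.

Theorem theorem1 (R : realType) (d d' : measure_display)
    (T : measurableType d) (X : measurableType d') (P : probability T R)
    (Dtr : {mfun T >-> X}) (kappa : R.-pker X ~> T)
    (n n' p : nat) (g : 'I_n -> 'I_n' -> bool)
    (fit : X -> 'rV[R]_p -> R)
    (Dcal : {fset int})
    (u_ : int -> 'I_n -> {RV P >-> R})
    (v_ : int -> 'I_n -> 'I_p -> {RV P >-> R})
    (u : 'I_n -> {RV P >-> R})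
    (v : 'I_n -> 'I_p -> {RV P >-> R})
    (xi : int -> {RV P >-> R}) (kfut : int)
    (alpha Gamma : R) :
  let uvec_ k w : 'rV[R]_n := \row_i u_ k i w in
  let uvec w : 'rV[R]_n := \row_i u i w in
  let phihat w : 'rV[R]_p -> R := fit (Dtr w) in
  let uhat_ k w := prediction (phihat w) (fun i => \row_j v_ k i j w) in
  let uhat w := prediction (phihat w) (fun i => \row_j v i j w) in
  let e_ k w := ncscore g (uvec_ k w) (uhat_ k w) in
  let e w := ncscore g (uvec w) (uhat w) in
  let Qhat a w := emp_quantile Dcal (e_ ^~ w) a in
  let U a w := uncertainty_set g (uhat w) (Qhat a w) in
  let m := #|` Dcal| in
  let eps := epsilon Gamma m in
  let alpha' := Num.max (alpha - eps) 0 in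
  regular_cond_prob P Dtr kappa ->
  is_grouping g ->
  (forall k i w, 0 <= u_ k i w) ->
  (forall i w, 0 <= u i w) ->
  0 < alpha < 1 ->
  (1 <= m)%N ->
  0 < Gamma ->
  (forall k, k \in Dcal -> k < kfut) ->
  (forall k w, k \in Dcal -> xi k w = e_ k w) ->
  (forall w, xi kfut w = e w) ->
  {ae P, forall w,
    [/\ strictly_stationary (kappa (Dtr w)) xi,
        alpha_mixing (kappa (Dtr w)) xi &
        (\sum_(1 <= l <oo) alpha_mix (kappa (Dtr w)) xi l <= Gamma%:E)%E]} ->
  [/\ {ae P, forall w,
        ((1 - alpha - eps)%:E <= kappa (Dtr w) [set w' | U alpha w' (uvec w')])%E},
      epsilon Gamma =O_\oo (@rate R) &
      {ae P, forall w,
        ((1 - alpha' - eps)%:E <= kappa (Dtr w) [set w' | U alpha' w' (uvec w')])%E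
        /\ (eps <= alpha ->
            ((1 - alpha)%:E <= kappa (Dtr w) [set w' | U alpha' w' (uvec w')])%E)}].
Proof.
move=> uvec_ uvec phihat uhat_ uhat e_ e Qhat U m eps alpha'.
move=> _ _ u_ge0 uf_ge0 /andP[alpha_gt0 alpha_lt1] m_gt0 Gamma_gt0 _.
move=> xiE xi_e mix.
have [delta delta_gt0 [epsE mdelta]] := epsilon_deviation _ _ _ Gamma_gt0 m_gt0.
(* The level stays general because both [alpha] and [alpha'] are needed. *)
have cov a : 0 <= a < 1 -> {ae P, forall w,
    ((1 - a - eps)%:E <= kappa (Dtr w) [set w' | U a w' (uvec w')])%E}.
  move=> a01; apply: filterS mix => w [st _ aG].
  pose mu : probability T R := kernel_probability _ _ _ _ _ kappa (Dtr w).
  have := emp_quantile_coverage _ _ _ mu xi Dcal kfut a Gamma delta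
    st aG a01 m_gt0 delta_gt0 mdelta.
  rewrite -epsE; congr (_ <= mu _)%E; apply/seteqP.
  have E w' : xi kfut w' <= emp_quantile Dcal (xi ^~ w') a <-> U a w' (uvec w').
    have QE : emp_quantile Dcal (xi ^~ w') a = Qhat a w'.
      by apply: eq_emp_quantile => k kD; exact: xiE.
    rewrite QE xi_e /U mem_uncertainty_set//; first by move=> i; rewrite mxE.
    (* The quantile is nonnegative: no score lies below 0, so the fraction there is 0. *)
    rewrite /Qhat le_emp_quantile// big1 ?mulr0 ?subr_gt0; last first.
      by move=> k _; rewrite ltNge normr_ge0.
    by case/andP: a01.
  by split=> w' /= /E.
split; first by apply: cov; rewrite (ltW alpha_gt0) alpha_lt1.
  exact: epsilon_rate.
have eps_gt0 : 0 < eps by rewrite /eps epsE mulr_gt0.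
apply: filterS (cov alpha' _) => [w h|]; last first.
  by rewrite le_max lexx orbT /= gt_max; apply/andP; split; lra.
(* When [eps <= alpha] the maximum is [alpha - eps], and [alpha' + eps = alpha]. *)
split=> // eps_le; apply: le_trans h; rewrite lee_fin /alpha' max_l; lra.
Qed.
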